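(* Let $(\mathbf{R},\le)$ be an ordered field, let $\mathbf{C}=\mathbf{R}[i]$, and let $d\in\mathbb{Z}_{\ge 1}$. If $(\mathbf{R},\le)$ satisfies $[\mathrm{IVT}]_{d^2}$, then $(\mathbf{R},\le)$ satisfies $[\mathrm{FTA}]_d$.
   Context: Let $(\mathbf{R},\le)$ be an ordered field. Then $-1$ is not a square in $\mathbf{R}$, and $\mathbf{C}:=\mathbf{R}[T]/\langle T^2+1\rangle=\mathbf{R}[i]$ is a field extension of $\mathbf{R}$ of degree $2$. For $n\in\mathbb{Z}_{\ge1}$: - $[\mathrm{IVT}]_n$ is the property: for every polynomial $F\in\mathbf{R}[X]$ with $\deg F\le n$ and every $a,b\in\mathbf{R}$ with $a<b$ and $F(a)F(b)<0$, there exists $c\in\mathbf{R}$ with $a<c<b$ such that $F(c)=0$. - $[\mathrm{FTA}]_n$ is the property: for every non-constant polynomial $F\in\mathbf{C}[Z]\setminus\mathbf{C}$ with $\deg F\le n$, there exists $z\in\mathbf{C}$ such that $F(z)=0$. *)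

(* Defs.v *)
From HB Require Import structures.
From mathcomp Require Import all_boot all_order all_algebra.
From mathcomp Require Import complex.

Set Implicit Arguments.
Unset Strict Implicit.
Unset Printing Implicit Defensive.

Import Order.TTheory GRing.Theory Num.Theory.
Local Open Scope ring_scope.

(* [size F <= n.+1] reads deg F <= n (with the zero polynomial allowed), and
   [1 < size F] reads: F is not constant. *)
Definition IVT (R : realFieldType) (n : nat) : Prop :=
  forall (F : {poly R}) (a b : R),
    (size F <= n.+1)%N -> a < b -> F.[a] * F.[b] < 0 ->
    exists c : R, a < c < b /\ F.[c] = 0.

Definition FTA (R : realFieldType) (n : nat) : Prop :=
  forall F : {poly R[i]},
    (1 < size F)%N -> (size F <= n.+1)%N ->
    exists z : R[i], F.[z] = 0.

(* The library builds R[i] on pairs of elements of R. The two facts below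
   identify it with the quotient R[T]/<T^2 + 1>: evaluation at i is a surjective
   ring morphism R[T] -> R[i] (see [rmorph_eval_i]) with kernel <T^2 + 1>. *)
Definition eval_i (R : realFieldType) : {poly R} -> R[i] :=
  fun p => (map_poly (real_complex R) p).['i%C].

Lemma rmorph_eval_i (R : realFieldType) :
  [/\ {morph @eval_i R : p q / p + q}, {morph @eval_i R : p q / p * q}
    & forall c : R, eval_i c%:P = (c%:C)%C].
Proof.
rewrite /eval_i; split=> [p q|p q|c]; first by rewrite rmorphD hornerD.
  by rewrite rmorphM hornerM.
by rewrite map_polyC hornerC.
Qed.

Lemma eval_i_linear (R : realFieldType) (a b : R) :
  eval_i (b *: 'X + a%:P) = (a +i* b)%C.
Proof.
rewrite /eval_i rmorphD /= map_polyZ map_polyX map_polyC hornerD hornerZ.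
rewrite hornerX hornerC; apply/eqP; rewrite eq_complex /=.
by rewrite mulr0 !mul0r subrr add0r mulr1 !addr0 !eqxx.
Qed.

Lemma eval_i_surj (R : realFieldType) (z : R[i]) : exists p, eval_i p = z.
Proof. by case: z => a b; exists (b *: 'X + a%:P); apply: eval_i_linear. Qed.

Lemma eval_i_ker (R : realFieldType) (p : {poly R}) :
  (eval_i p == 0) = ('X^2 + 1 %| p).
Proof.
have [evD evM evC] := rmorph_eval_i R.
have s3 : size ('X^2 + 1 : {poly R}) = 3%N.
  by rewrite -[1]/(1%:P) size_XnaddC.
have ev0 : eval_i ('X^2 + 1 : {poly R}) = 0.
  rewrite /eval_i rmorphD rmorph1 /= map_polyXn hornerD hornerXn hornerC.
  apply/eqP; rewrite expr2 eq_complex /=.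
  by rewrite !(mulr0, mul0r, mulr1, sub0r, addr0, addNr) !eqxx.
have nz : 'X^2 + 1 != 0 :> {poly R} by rewrite -size_poly_eq0 s3.
have lt2 : (size (p %% ('X^2 + 1))%R <= 2)%N by rewrite -ltnS -s3 ltn_modp.
rewrite {1}(divp_eq p ('X^2 + 1)) evD evM ev0 mulr0 add0r /dvdp.
set r := p %% _; rewrite -/r in lt2.
have -> : r = r`_1 *: 'X + (r`_0)%:P.
  apply/polyP=> -[|[|k]]; rewrite coefD coefZ coefX coefC /=.
  - by rewrite mulr0 add0r.
  - by rewrite mulr1 addr0.
  by rewrite mulr0 addr0 nth_default // (leq_trans lt2).
rewrite eval_i_linear eq_complex /=; apply/andP/eqP => [[/eqP-> /eqP->]|].
  by rewrite scale0r addr0.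
move=> e; have := congr1 (coefp 0) e; have := congr1 (coefp 1) e.
rewrite /= !(coefD, coefZ, coefX, coefC, coef0) /= mulr1 mulr0 addr0 add0r.
by move=> -> ->; rewrite !eqxx.
Qed.

(* Main.v *)
(* Let F be a monic polynomial of minimal degree n without roots in C, with
   vanishing coefficient of Z^(n-1), and let F_t(Z) = t^n F((Z + t - 1) / t),
   a path from (Z - 1)^n at t = 0 to F at t = 1. Writing P* for the conjugate
   of P, the Bezoutian of Hermite and Routh-Hurwitz,
     (F_t*(-Z) F_t(-W) - F_t(Z) F_t*(W)) / (Z + W),
   is a Hermitian n x n matrix. Its (j, k) entry has degree at most
   2n - 1 - j - k in t, so that all its principal minors have degree at most
   n^2, and it is singular only if F_t(-Z) and F_t*(Z) have a common factor. It
   is positive definite at t = 0, but not at t = 1, where its last diagonal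
   entry is 0. By IVT_(n^2) a path of Hermitian matrices of this kind can leave
   the positive definite cone only through a singular matrix (induction on the
   size, looking at the first zero of a minor). At the corresponding t, the
   minimality of n makes F_t(-Z) and F_t*(Z) proportional; comparing
   coefficients yields t = 1 and F(0)* = (-1)^n F(0). The same holds for the
   rescaled polynomials F(uZ) / u^n, hence u^n is real for every u <> 0, which
   is absurd. *)
Require Import Defs.
From HB Require Import structures.
From mathcomp Require Import all_boot all_order all_algebra.
From Stdlib Require Import Classical.
From mathcomp Require Import perm complex polyXY.
From mathcomp Require Import zify ring lra.

Set Implicit Arguments.
Unset Strict Implicit.
Unset Printing Implicit Defensive.

Import Order.TTheory GRing.Theory Num.Theory.
Local Open Scope ring_scope.

(* Abstracts the pair R, R[i], because the library equips R[i] with an order and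
   with a conjugation morphism only when R is real closed. *)
Record complexification (R : realFieldType) (C : fieldType) :=
  Complexification {
  cconj : {rmorphism C -> C};
  emb : {rmorphism R -> C};
  cre : {additive C -> R};
  cconjK : involutive cconj;
  cconj_emb : forall x, cconj (emb x) = emb x;
  cre_emb : cancel emb cre;
  cre_conj : forall z, cre (cconj z) = cre z;
  creM_emb : forall z x, cre (z * emb x) = cre z * x;
  cconj_fixed : forall z, cconj z = z -> z = emb (cre z);
  cre_sqnorm_ge0 : forall z, 0 <= cre (cconj z * z);
  cre_sqnorm_eq0 : forall z, (cre (cconj z * z) == 0) = (z == 0)
}.

(** * Hermitian forms *)

Section HermitianForms.
Variables (R : realFieldType) (C : fieldType) (K : complexification R C).
Local Notation cconj := (cconj K).
Local Notation emb := (emb K).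
Local Notation cre := (cre K).

Lemma cre1 : cre 1 = 1.
Proof. by rewrite -(rmorph1 emb) cre_emb. Qed.

Lemma sqnormE z : cconj z * z = emb (cre (cconj z * z)).
Proof. by apply: cconj_fixed; rewrite rmorphM cconjK mulrC. Qed.

Lemma cre_sqnorm_gt0 z : z != 0 -> 0 < cre (cconj z * z).
Proof. by move=> nz; rewrite lt_def cre_sqnorm_eq0 nz cre_sqnorm_ge0. Qed.

Definition adj m n (A : 'M[C]_(m, n)) : 'M[C]_(n, m) := (map_mx cconj A)^T.

Definition hform n (H : 'M[C]_n) (u v : 'cV[C]_n) : C := (adj u *m H *m v) 0 0.

Definition hermitian n (H : 'M[C]_n) := adj H = H.

Definition posdef n (H : 'M[C]_n) :=
  forall v : 'cV[C]_n, v != 0 -> 0 < cre (hform H v v).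

Lemma adjM m n p (A : 'M[C]_(m, n)) (B : 'M[C]_(n, p)) :
  adj (A *m B) = adj B *m adj A.
Proof. by rewrite /adj map_mxM trmx_mul. Qed.

Lemma adjK m n (A : 'M[C]_(m, n)) : adj (adj A) = A.
Proof. by apply/matrixP=> i j; rewrite !mxE cconjK. Qed.

Lemma det_adj n (A : 'M[C]_n) : \det (adj A) = cconj (\det A).
Proof. by rewrite /adj det_tr det_map_mx. Qed.

Lemma hform_conj n (H : 'M[C]_n) u v :
  hermitian H -> cconj (hform H u v) = hform H v u.
Proof.
move=> hH; have -> : cconj (hform H u v) = adj (adj u *m H *m v) 0 0.
  by rewrite /hform !mxE.
by rewrite !adjM adjK hH mulmxA.
Qed.

Lemma det_hermitian n (H : 'M[C]_n) :
  hermitian H -> \det H = emb (cre (\det H)).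
Proof. by move=> hH; apply: cconj_fixed; rewrite -det_adj hH. Qed.

Lemma adjD m n (A B : 'M[C]_(m, n)) : adj (A + B) = adj A + adj B.
Proof. by apply/matrixP=> i j; rewrite !mxE rmorphD. Qed.

Lemma adjZ m n a (A : 'M[C]_(m, n)) : adj (a *: A) = cconj a *: adj A.
Proof. by apply/matrixP=> i j; rewrite !mxE rmorphM. Qed.

Lemma hformDr n (H : 'M[C]_n) u v w :
  hform H u (v + w) = hform H u v + hform H u w.
Proof. by rewrite /hform mulmxDr mxE. Qed.

Lemma hformDl n (H : 'M[C]_n) u v w :
  hform H (u + v) w = hform H u w + hform H v w.
Proof. by rewrite /hform adjD !mulmxDl mxE. Qed.

Lemma hformZr n (H : 'M[C]_n) a u v : hform H u (a *: v) = a * hform H u v.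
Proof. by rewrite /hform -scalemxAr mxE. Qed.

Lemma hformZl n (H : 'M[C]_n) a u v :
  hform H (a *: u) v = cconj a * hform H u v.
Proof. by rewrite /hform adjZ -!scalemxAl mxE. Qed.

(** If the form vanishes at v, then with w = H v the map s -> q(v + s w) is a nonnegative quadratic
    without constant term. So its linear coefficient, twice the squared norm of w, is 0, and
    invertibility gives v = 0. *)
Lemma semidef_unit_posdef n (H : 'M[C]_n) :
    hermitian H -> (forall v, 0 <= cre (hform H v v)) -> \det H != 0 ->
  posdef H.
Proof.
move=> hH H_ge0 detH v nz_v; rewrite lt_def H_ge0 andbT.
apply: contra nz_v => /eqP qv0.
set w := H *m v.
have qw : cre (hform H w v) = \sum_i cre (cconj (w i 0) * w i 0).
  rewrite /hform -mulmxA -/w mxE raddf_sum; apply: eq_bigr => i _.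
  by rewrite !mxE.
have qw0 : cre (hform H w v) = 0.
  set a := cre _; set b := cre (hform H w w).
  have b_ge0 : 0 <= b by apply: H_ge0.
  have par s : 0 <= s * a *+ 2 + s ^+ 2 * b.
    have := H_ge0 (v + emb s *: w).
    rewrite hformDl !hformDr hformZr !hformZl hformZr cconj_emb !raddfD /=.
    rewrite -(hform_conj w v hH) mulrC (mulrC (emb s) (hform _ w v)).
    rewrite mulrA -rmorphM (mulrC (emb _) (hform _ w w)) !creM_emb cre_conj.
    rewrite qv0 add0r addrA -mulr2n -/a -/b => h.
    by rewrite (mulrC s a) expr2 (mulrC _ b).
  have b1 : 0 < 1 + b by lra.
  (* The minimum lies at s = -a / b, but b may be 0; with 1 + b the value is still negative unless a
     = 0. *)
  have := par (- a / (1 + b)).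
  have -> : - a / (1 + b) * a *+ 2 + (- a / (1 + b)) ^+ 2 * b =
            - (a ^+ 2 * (2 + b) / (1 + b) ^+ 2) by field; lra.
  rewrite oppr_ge0 pmulr_lle0 ?invr_gt0 ?exprn_gt0 // pmulr_lle0; last lra.
  by move=> h; apply/eqP; rewrite -sqrf_eq0 eq_le h sqr_ge0.
have w0 : w = 0.
  apply/matrixP=> i j; rewrite ord1 [RHS]mxE; apply/eqP.
  move: qw0; rewrite qw => /eqP; rewrite psumr_eq0 => [/allP|k _]; last first.
    exact: cre_sqnorm_ge0.
  by move/(_ i (mem_index_enum _))/implyP/(_ isT); rewrite cre_sqnorm_eq0.
have uH : H \in unitmx by rewrite unitmxE unitfE.
by rewrite -(mulKmx uH v) -/w w0 mulmx0.
Qed.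

(** Block Gaussian elimination: a unipotent P turns H into the block diagonal matrix
    [adj P *m H *m P] of the Schur complement s and the trailing block. Determinants give the first
    claim, completing the square the second. *)
Lemma hermitian_schur n (H : 'M[C]_(1 + n)) :
    hermitian H -> \det (drsubmx H) != 0 ->
  exists (s : C) (c : 'cV[C]_n), \det H = s * \det (drsubmx H) /\
    forall x y, hform H (col_mx x%:M (y - x *: c)) (col_mx x%:M (y - x *: c)) =
      s * (cconj x * x) + hform (drsubmx H) y y.
Proof.
set M := drsubmx H; set u := ursubmx H; set a := ulsubmx H; set u' := dlsubmx H.
move=> hH detM; have uM : M \in unitmx by rewrite unitmxE unitfE.
have eH : H = block_mx a u u' M by rewrite submxK.
have adj_block m1 m2 n1 n2 (A : 'M[C]_(m1, n1)) B (D : 'M[C]_(m2, n1)) E :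
    adj (block_mx A B D E : 'M_(m1 + m2, n1 + n2)) =
    block_mx (adj A) (adj D) (adj B) (adj E).
  by rewrite /adj map_block_mx tr_block_mx.
have [_ _ hu hM] : [/\ adj a = a, adj u' = u, adj u = u' & adj M = M].
  by apply: eq_block_mx; rewrite -adj_block -eH.
pose c := invmx M *m u'.
have Mc : M *m c = u' by rewrite mulKVmx.
pose S := a - u *m c; pose P : 'M[C]_(1 + n) := block_mx 1%:M 0 (- c) 1%:M.
have HP : H *m P = block_mx S u 0 M.
  rewrite eH mulmx_block !mulmx1 !mulmx0 !add0r !mulmxN Mc subrr.
  by [].
have aP : adj P = block_mx 1%:M (- adj c) 0 1%:M.
  rewrite adj_block /adj !map_mx1 !trmx1 map_mx0 trmx0; congr block_mx.
  by apply/matrixP=> i j; rewrite !mxE rmorphN.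
have cM : adj c *m M = u by rewrite -{1}hM -adjM Mc -hu adjK.
have PHP : adj P *m H *m P = block_mx S 0 0 M.
  rewrite -mulmxA HP aP mulmx_block !mulNmx cM.
  by rewrite !mul1mx !mul0mx !mulmx0 oppr0 !add0r !addr0 subrr.
exists (S 0 0), c; split.
  have := det_mulmx H P; rewrite HP (@det_ublock _ 1 n) (@det_lblock _ 1 n).
  by rewrite !det1 !mulr1 det_mx11.
move=> x y; have -> : col_mx x%:M (y - x *: c) = P *m col_mx x%:M y.
  rewrite mul_block_col !mul1mx mul0mx addr0 mulNmx.
  by rewrite mul_mx_scalar addrC.
rewrite /hform adjM !mulmxA -(mulmxA _ (adj P)) -(mulmxA _ _ P) PHP.
have -> : adj (col_mx x%:M y) = row_mx (adj x%:M) (adj y).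
  by rewrite /adj map_col_mx tr_col_mx.
rewrite (@mul_row_block _ _ 1 n 1 n) !mulmx0 addr0 add0r (@mul_row_col _ 1 1 n).
rewrite mxE; congr (_ + _); rewrite !mxE !big_ord1 !mxE !big_ord1 !mxE eqxx.
rewrite !mulr1n mulrAC mulrC; congr (_ * _).
Qed.

Lemma posdef_drsubmx n (H : 'M[C]_(1 + n)) : posdef H -> posdef (drsubmx H).
Proof.
move=> pH v nz_v; have := pH (col_mx 0 v).
rewrite col_mx_eq0 (negbTE nz_v) andbF => /(_ isT).
rewrite /hform -{1}(submxK H) /adj map_col_mx tr_col_mx map_mx0 trmx0.
rewrite (@mul_row_block _ 1 1 n 1 n) !mul0mx !add0r (@mul_row_col _ 1 1 n).
by rewrite mulmx0 add0r.
Qed.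

Lemma hermitian_drsubmx n (H : 'M[C]_(1 + n)) :
  hermitian H -> hermitian (drsubmx H).
Proof.
move=> hH; apply/matrixP=> i j; rewrite !mxE -[in RHS]hH.
by rewrite !mxE.
Qed.

Lemma posdef_det n (H : 'M[C]_n) :
  hermitian H -> posdef H -> 0 < cre (\det H).
Proof.
elim: n H => [|n IHn] H hH pH; first by rewrite det_mx00 cre1.
have hM := hermitian_drsubmx (hH : hermitian (H : 'M_(1 + n))).
have M_gt0 := IHn _ hM (posdef_drsubmx (pH : posdef (H : 'M_(1 + n)))).
have nzM : \det (drsubmx (H : 'M_(1 + n))) != 0.
  by apply: contraTneq M_gt0 => ->; rewrite raddf0 ltxx.
have [s [c [-> hq]]] := hermitian_schur (hH : hermitian (H : 'M_(1 + n))) nzM.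
rewrite (det_hermitian hM) creM_emb mulr_gt0 //.
(* At x = 1, y = 0 the form takes the value s. *)
have nz : col_mx 1%:M (0 - 1 *: c) != 0.
  by rewrite (@col_mx_eq0 _ 1 n) negb_and oner_neq0.
have := pH _ nz; rewrite hq rmorph1 !mulr1.
by rewrite /hform mulmx0 mxE addr0.
Qed.

(** Inductive step of Sylvester's criterion: s is a quotient of two positive determinants, and the
    form is s |x|^2 plus the form of the trailing block. *)
Lemma posdef_schur n (H : 'M[C]_(1 + n)) :
  hermitian H -> posdef (drsubmx H) -> 0 < cre (\det H) -> posdef H.
Proof.
move=> hH pM H_gt0 v nz_v; have hM := hermitian_drsubmx hH.
have M_gt0 := posdef_det hM pM.
have nzM : \det (drsubmx H) != 0.
  by apply: contraTneq M_gt0 => ->; rewrite raddf0 ltxx.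
have [s [c [eH hq]]] := hermitian_schur hH nzM.
have s_gt0 : 0 < cre s.
  by move: H_gt0; rewrite eH (det_hermitian hM) creM_emb pmulr_lgt0.
pose x := usubmx v 0 0; pose y := dsubmx v + x *: c.
have ev : v = col_mx x%:M (y - x *: c).
  by rewrite /y addrK -mx11_scalar vsubmxK.
rewrite ev hq raddfD /= sqnormE creM_emb.
have [x0|nz_x] := eqVneq x 0; last first.
  rewrite ltr_pwDl ?mulr_gt0 ?cre_sqnorm_gt0 //.
  have [->|nz_y] := eqVneq y 0; last exact/ltW/pM.
  by rewrite /hform mulmx0 mxE raddf0.
rewrite x0 mulr0 raddf0 mulr0 add0r; apply: pM.
apply: contra nz_v => /eqP y0.
by rewrite ev x0 y0 scale0r subr0 raddf0 col_mx0.
Qed.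

End HermitianForms.

(** * Paths of Hermitian matrices *)

Section DefinitePaths.
Variables (R : realFieldType) (C : fieldType) (K : complexification R C).
Local Notation cconj := (cconj K).
Local Notation emb := (emb K).
Local Notation cre := (cre K).

(* The hypothesis says that no point of [a, b] is the first root of p in it. *)
Lemma no_first_root (p : {poly R}) (a b : R) :
    p != 0 ->
    (forall c, a <= c <= b -> (forall x, a <= x < c -> p.[x] != 0) ->
      p.[c] != 0) ->
  forall c, a <= c <= b -> p.[c] != 0.
Proof.
(* Given a root c, dividing by X - c lowers the size and keeps the roots below c, so induction
   applies on each [a, x] with x < c and makes c a first root. *)
have [m] := ubnP (size p); elim: m p b => // m IHm p b sp nz_p first c acb.
apply/negP => /eqP pc0; have /factor_theorem[q eq_p] : root p c by apply/rootP.
have nz_q : q != 0 by apply: contraNneq nz_p => q0; rewrite eq_p q0 mul0r.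
have ep x : (p.[x] == 0) = (q.[x] == 0) || (x == c).
  by rewrite eq_p hornerM hornerXsubC mulf_eq0 subr_eq0.
suff noroot : forall x, a <= x < c -> p.[x] != 0.
  by have := first c acb noroot; rewrite pc0 eqxx.
move=> x /andP[ax xc]; rewrite ep (lt_eqF xc) orbF.
apply: (IHm _ x) => //; last by rewrite ax lexx.
  by move: sp; rewrite eq_p size_Mmonic ?monicXsubC // size_XsubC addn2.
move=> c' /andP[ac' c'x] noroot.
have c'c : c' < c by apply: le_lt_trans c'x xc.
have c'b : a <= c' <= b by rewrite ac' (le_trans (ltW c'c)) //; case/andP: acb.
have := first c' c'b; rewrite ep (lt_eqF c'c) orbF; apply=> y /andP[ay yc'].
rewrite ep (lt_eqF (lt_trans yc' c'c)) orbF.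
by apply: noroot; rewrite ay yc'.
Qed.

(** Substitute for continuity at b: a negative value would produce a root strictly before it.
    Nothing is assumed about p at b itself, where it may vanish. *)
Lemma IVT_ge0 N (p : {poly R}) (a b : R) :
    IVT R N -> (size p <= N.+1)%N -> 0 < p.[a] ->
    (forall x, a <= x < b -> p.[x] != 0) ->
  forall x, a <= x <= b -> 0 <= p.[x].
Proof.
move=> ivt sp pa nz x /andP[ax xb].
rewrite leNgt; apply/negP => px.
have a_x : a < x by rewrite lt_def ax andbT; apply: contraTneq px => ->; lra.
have papx : p.[a] * p.[x] < 0 by rewrite pmulr_rlt0.
have [c [/andP[ac cx] pc]] := ivt p a x sp a_x papx.
by have := nz c; rewrite pc eqxx (ltW ac) (lt_le_trans cx xb) => /(_ isT).
Qed.

Lemma horner_map_cre (p : {poly C}) (x : R) :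
  (map_poly cre p).[x] = cre p.[emb x].
Proof.
rewrite horner_poly horner_coef raddf_sum; apply: eq_bigr => i _.
by rewrite -rmorphXn creM_emb.
Qed.

(** In the Leibniz formula the term of a permutation s has degree at most the sum of the e i + e (s
    i) + 1, which does not depend on s. *)
Lemma size_det (A : idomainType) n (M : 'M[{poly A}]_n) (e : 'I_n -> nat) :
    (forall i j, size (M i j) <= e i + e j + 2)%N ->
  (size (\det M) <= (\sum_i (e i).*2.+1).+1)%N.
Proof.
move=> sM; apply: (leq_trans (size_sum _ _ _)); apply/bigmax_leqP=> s _.
rewrite size_Msign; apply: (leq_trans (size_poly_prod_leq _ _)).
rewrite leq_subLR addnS ltnS.
apply: (@leq_trans (\sum_i (e i + e (s i) + 2))%N); first exact: leq_sum.
rewrite !big_split /= [X in (_ + X + _)%N](_ : _ = (\sum_i e i)%N); last first.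
  by rewrite [RHS](reindex_inj (@perm_inj _ s)).
under [X in (_ <= _ + X)%N]eq_bigr do rewrite -addnn -addn1.
rewrite !big_split /= !sum_nat_const !muln1 muln2 -addnn.
by rewrite ?cardT ?size_enum_ord; lia.
Qed.

Definition eval_mx n (M : 'M[{poly C}]_n) (x : R) : 'M[C]_n :=
  map_mx (horner_eval (emb x)) M.

Lemma det_eval_mx n (M : 'M[{poly C}]_n) x :
  \det (eval_mx M x) = (\det M).[emb x].
Proof. by rewrite det_map_mx. Qed.

Lemma hform_eval_mx N n (M : 'M[{poly C}]_n) (v : 'cV[C]_n) :
    (forall i j, size (M i j) <= N.+1)%N ->
  exists2 p : {poly R}, (size p <= N.+1)%N &
    forall x, cre (hform K (eval_mx M x) v v) = p.[x].
Proof.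
move=> sM.
pose p := \sum_j \sum_i (cconj (v i 0) * v j 0) *: M i j.
exists (map_poly cre p).
  apply: (leq_trans (size_poly _ _)).
  apply: (leq_trans (size_sum _ _ _)); apply/bigmax_leqP=> j _.
  apply: (leq_trans (size_sum _ _ _)); apply/bigmax_leqP=> i _.
  exact: leq_trans (size_scale_leq _ _) (sM i j).
move=> x; rewrite horner_map_cre; congr (cre _).
rewrite /hform mxE horner_sum; apply: eq_bigr => j _.
rewrite mxE mulr_suml horner_sum; apply: eq_bigr => i _.
by rewrite !mxE hornerZ /horner_eval mulrAC.
Qed.

(** Nonvanishing is given for det M only and must be derived for the trailing block M' before
    induction applies to it. Before a first root c of D', both M' and M are definite. By IVT the
    form of M is semidefinite at c, hence definite because M is invertible there, so D' does not
    vanish at c. *)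
Lemma posdef_path N n (M : 'M[{poly C}]_n) (e : 'I_n -> nat) (a b : R) :
    IVT R N ->
    (forall i j, size (M i j) <= e i + e j + 2)%N ->
    (\sum_i (e i).*2.+1 <= N)%N ->
    (forall x, hermitian K (eval_mx M x)) ->
    posdef K (eval_mx M a) ->
    (forall x, a <= x <= b -> \det (eval_mx M x) != 0) ->
  forall x, a <= x <= b -> posdef K (eval_mx M x).
Proof.
move=> ivt; elim: n M e a b => [|n IHn] M e a b sM eN hM pMa nzM.
  by move=> x _ v; rewrite flatmx0 eqxx.
pose M' := drsubmx (M : 'M_(1 + n)); pose e' i := e (rshift 1 i).
have evM' x : eval_mx M' x = drsubmx (eval_mx M x : 'M_(1 + n)).
  by apply/matrixP=> i j; rewrite !mxE.
have hM' x : hermitian K (eval_mx M' x).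
  by rewrite evM'; apply: hermitian_drsubmx (hM x).
have pM'a : posdef K (eval_mx M' a) by rewrite evM'; apply: posdef_drsubmx.
have sM' i j : (size (M' i j) <= e' i + e' j + 2)%N by rewrite !mxE.
have e'N : (\sum_i (e' i).*2.+1 <= N)%N.
  by apply: leq_trans eN; rewrite (@big_split_ord _ _ _ 1 n) /= leq_addl.
have IH b' := IHn M' e' a b' sM' e'N hM' pM'a.
pose D := map_poly cre (\det M); pose D' := map_poly cre (\det M').
have sD : (size D <= N.+1)%N.
  by apply: (leq_trans (size_poly _ _)); apply: leq_trans (size_det sM) _.
have DE x : D.[x] = cre (\det (eval_mx M x)).
  by rewrite horner_map_cre det_eval_mx.
have D'E x : D'.[x] = cre (\det (eval_mx M' x)).
  by rewrite horner_map_cre det_eval_mx.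
have nzD x : a <= x <= b -> D.[x] != 0.
  move=> /nzM; apply: contraNneq => D0.
  by rewrite (det_hermitian (hM x)) -DE D0 rmorph0.
have D_gt0 x : a <= x <= b -> 0 < D.[x].
  move=> axb; rewrite lt_def nzD //=.
  apply: (IVT_ge0 ivt sD) axb; first by rewrite DE; apply: posdef_det.
  by move=> y /andP[ay yb]; rewrite nzD // ay ltW.
have glue x : a <= x <= b -> posdef K (eval_mx M' x) -> posdef K (eval_mx M x).
  move=> axb pM'; apply: (@posdef_schur _ _ _ n) => //; first by rewrite -evM'.
  by rewrite -DE D_gt0.
have nz_det' x : (D'.[x] != 0) = (\det (eval_mx M' x) != 0).
  rewrite D'E (det_hermitian (hM' x)) cre_emb.
  by rewrite -(fmorph_eq0 emb).
have D'a : D'.[a] != 0 by rewrite D'E gt_eqF // posdef_det.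
have nzD' x : a <= x <= b -> D'.[x] != 0.
  apply: no_first_root x; first by apply: contraNneq D'a => ->; rewrite horner0.
  move=> c /andP[ac cb] noroot.
  have [<- // | neq_ac] := eqVneq a c.
  have a_c : a < c by rewrite lt_def eq_sym neq_ac.
  have pM x : a <= x < c -> posdef K (eval_mx M x).
    move=> /andP[ax xc]; apply: glue; first by rewrite ax (le_trans (ltW xc)).
    apply: (IH x); last by rewrite ax lexx.
    move=> y /andP[ay yx]; rewrite -nz_det'; apply: noroot.
    by rewrite ay (le_lt_trans yx).
  suff pMc : posdef K (eval_mx M c).
    by rewrite D'E gt_eqF // posdef_det // evM'; apply: posdef_drsubmx.
  apply: semidef_unit_posdef (nzM c _); [exact: hM | | by rewrite ac].
  move=> v; have [->|nz_v] := eqVneq v 0; first by rewrite /hform mulmx0 mxE raddf0.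
  have sMN i j : (size (M i j) <= N.+1)%N.
    have le_e k : ((e k).*2.+1 <= N)%N.
      by apply: leq_trans eN; rewrite (bigD1 k) //= leq_addr.
    apply: (leq_trans (sM i j)); have := le_e i; have := le_e j.
    by rewrite -!addnn; lia.
  have [p sp Ep] := hform_eval_mx v sMN; rewrite Ep.
  apply: (IVT_ge0 ivt sp (a := a) (b := c)); last by rewrite ac lexx.
    by rewrite -Ep; apply: pMa.
  by move=> y ayc; rewrite -Ep gt_eqF //; apply: pM.
by move=> x axb; apply: glue => //; apply: (IH b) axb => y /nzD'; rewrite nz_det'.
Qed.

End DefinitePaths.

(** * Bezoutians *)

Section Bezoutian.

Lemma coef_comp_polyN (A : comNzRingType) (p : {poly A}) i :
  (p \Po - 'X)`_i = (-1) ^+ i * p`_i.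
Proof.
elim/poly_ind: p i => [|p c IHp] i; first by rewrite comp_poly0 !coef0 mulr0.
rewrite comp_polyD comp_polyM comp_polyX comp_polyC !coefD !coefC mulrN coefN.
rewrite !coefMX; case: i => [|i] /=; first by rewrite oppr0 expr0 mul1r.
by rewrite IHp !addr0 exprS mulN1r mulNr.
Qed.

Variable A : idomainType.
Implicit Types (P Q : {poly A}) (B : {poly {poly A}}).

(* With Z = 'X and W = 'Y, the Bezoutian of P and Q is
   (Q(-Z) P(-W) - P(Z) Q(W)) / (Z + W). *)
Definition bezout_num P Q : {poly {poly A}} :=
  (Q \Po - 'X)^:P * (P \Po - 'X)%:P - P^:P * Q%:P.

Definition bezoutian P Q B := bezout_num P Q = B * ('X + 'Y).

Lemma bezoutian_exists P Q : exists B, bezoutian P Q B.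
Proof.
have /factor_theorem[B eB] : root (bezout_num P Q) (- 'X).
  apply/rootP; rewrite /bezout_num hornerD hornerN !hornerM !hornerC.
  rewrite -/(_ \Po _) -/(P \Po _) -comp_polyA; apply/eqP; rewrite subr_eq0.
  by rewrite mulrC raddfN /= comp_polyX opprK comp_polyXr.
by exists B; rewrite /bezoutian eB polyCN opprK.
Qed.

Lemma XaddY_monic : ('X + 'Y : {poly {poly A}}) \is monic.
Proof. by rewrite -['Y]opprK -polyCN monicXsubC. Qed.

Lemma bezoutian_inj P Q B B' : bezoutian P Q B -> bezoutian P Q B' -> B = B'.
Proof.
rewrite /bezoutian => -> /mulIf; apply; exact: monic_neq0 XaddY_monic.
Qed.

Lemma coef_bezout_num P Q i :
  (bezout_num P Q)`_i = ((-1) ^+ i * Q`_i) *: (P \Po - 'X) - P`_i *: Q.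
Proof. by rewrite coefB !coefMC !coef_map /= coef_comp_polyN !mul_polyC. Qed.

Lemma coef2_bezout_num P Q i j :
  (bezout_num P Q)`_i`_j = (-1) ^+ (i + j) * (Q`_i * P`_j) - P`_i * Q`_j.
Proof.
by rewrite coef_bezout_num coefB !coefZ coef_comp_polyN exprD; ring.
Qed.

Lemma bezoutian_coef0 P Q B : bezoutian P Q B -> (bezout_num P Q)`_0 = B`_0 * 'X.
Proof. by move->; rewrite mulrDr coefD coefMX coefMC add0r. Qed.

Lemma bezoutian_coefS P Q B i :
  bezoutian P Q B -> (bezout_num P Q)`_i.+1 = B`_i + B`_i.+1 * 'X.
Proof. by move->; rewrite mulrDr coefD coefMX coefMC. Qed.

(** Division by Z + W as a recursion that lowers i and raises j; degree bounds pass from the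
    numerator to B through it. *)
Lemma bezoutian_coef2 P Q B i j : bezoutian P Q B ->
  B`_i`_j = (bezout_num P Q)`_i`_j.+1 - (if i is k.+1 then B`_k`_j.+1 else 0).
Proof.
move=> hB; case: i => [|i].
  by rewrite (bezoutian_coef0 hB) coefMX /= subr0.
by rewrite (bezoutian_coefS i hB) coefD coefMX /= addrAC subrr add0r.
Qed.

Lemma size_bezoutian P Q B n :
  (size P <= n.+1)%N -> (size Q <= n.+1)%N -> bezoutian P Q B -> (size B <= n)%N.
Proof.
move=> sP sQ hB; have [->|nzB] := eqVneq B 0; first by rewrite size_poly0.
have : (size (B * ('X + 'Y))%R <= n.+1)%N.
  rewrite -hB; apply/leq_sizeP=> i ni; rewrite coef_bezout_num.
  by rewrite !(leq_sizeP _ _ sP _ ni, leq_sizeP _ _ sQ _ ni) mulr0 !scale0r subrr.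
rewrite size_Mmonic ?XaddY_monic //.
by rewrite -['Y]opprK -polyCN size_XsubC addn2.
Qed.

Lemma size_coef_bezoutian P Q B n i :
  (size P <= n.+1)%N -> (size Q <= n.+1)%N -> bezoutian P Q B ->
  (size (B`_i)%R <= n)%N.
Proof.
move=> sP sQ hB; apply/leq_sizeP; elim: i => [|i IHi] j nj.
all: rewrite (bezoutian_coef2 _ _ hB) coef2_bezout_num.
all: rewrite (leq_sizeP _ _ sP j.+1) ?(leq_sizeP _ _ sQ j.+1) ?ltnS // !mulr0.
  by rewrite !subr0.
by rewrite IHi ?subr0 // leqW.
Qed.

End Bezoutian.

Lemma bezoutian_map (A A' : idomainType) (f : {rmorphism A -> A'}) P Q B :
  bezoutian P Q B ->
  bezoutian (map_poly f P) (map_poly f Q) (map_poly (map_poly f) B).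
Proof.
move=> hB; rewrite /bezoutian; have <- : map_poly (map_poly f) ('X + 'Y) = 'X + 'Y.
  by rewrite rmorphD /= map_polyX map_polyC /= map_polyX.
rewrite -rmorphM -hB; apply/polyP=> i; apply/polyP=> j.
rewrite coef2_bezout_num !coef_map /= coef2_bezout_num.
by rewrite rmorphB !rmorphM rmorph_sign.
Qed.

(** Applying f to the coefficients and exchanging Z and W fixes both the numerator and Z + W, hence
    also their unique quotient. *)
Lemma bezoutian_hermitian (A : idomainType) (f : {rmorphism A -> A}) P B i j :
    involutive f -> bezoutian P (map_poly f P) B ->
  f B`_j`_i = B`_i`_j.
Proof.
move=> fK hB; pose B' := swapXY (map_poly (map_poly f) B).
suff hB' : bezoutian P (map_poly f P) B'.
  by rewrite [in RHS](bezoutian_inj hB hB') coef_swapXY !coef_map.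
have fP : map_poly f (map_poly f P) = P.
  by apply/polyP=> k; rewrite !coef_map /= fK.
have sXY : swapXY ('X + 'Y) = 'X + 'Y :> {poly {poly A}}.
  by rewrite rmorphD /= swapXY_X swapXY_Y addrC.
have := bezoutian_map f hB; rewrite /bezoutian fP => /(congr1 (@swapXY A)).
rewrite rmorphM /= sXY => <-.
apply/polyP=> k; apply/polyP=> l; rewrite coef_swapXY !coef2_bezout_num.
by rewrite addnC (mulrC P`_l) (mulrC _ P`_k).
Qed.

(** * Nonsingularity of the Bezoutian of coprime polynomials *)

Section BezoutianKernel.
Variable F : fieldType.

(** A kernel vector c defines a linear form l on F[W] modulo Q with l(W^k) = c_k, which kills the
    coefficients of B in Z. The recursion for these coefficients shows that l kills the whole ideal
    of P(-W); as P(-W) and Q are coprime, l = 0. *)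
Lemma bezoutian_det_neq0 (P Q : {poly F}) B n :
    size P = n.+1 -> size Q = n.+1 -> bezoutian P Q B ->
    coprimep Q (P \Po - 'X) ->
  \det (\matrix_(i < n, j < n) B`_i`_j) != 0.
Proof.
move=> sP sQ hB /Bezout_eq1_coprimepP[[u v] /= uv1].
rewrite -det_tr; apply/det0P => -[c nz_c cB].
case: n => [|n] in sP sQ c nz_c cB *; first by case/eqP: nz_c; apply/rowP => -[].
pose l (p : {poly F}) := \sum_k c 0 k * (p %% Q)`_k.
have lD p q : l (p + q) = l p + l q.
  by rewrite /l -big_split; apply: eq_bigr => k _; rewrite modpD coefD mulrDr.
have lZ a p : l (a *: p) = a * l p.
  by rewrite /l mulr_sumr; apply: eq_bigr => k _; rewrite modpZl coefZ mulrCA.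
have lB p q : l (p - q) = l p - l q by rewrite -scaleN1r lD lZ mulN1r.
have lQ p : l (p * Q) = 0.
  by rewrite /l big1 // => k _; rewrite modp_mull coef0 mulr0.
have l_small (p : {poly F}) : (size p <= n.+1)%N -> l p = \sum_k c 0 k * p`_k.
  by move=> sp; rewrite /l modp_small // sQ.
have sPn : (size P <= n.+2)%N by rewrite sP.
have sQn : (size Q <= n.+2)%N by rewrite sQ.
have Bhigh i : (n < i)%N -> B`_i = 0.
  by move=> ni; rewrite (leq_sizeP _ _ (size_bezoutian sPn sQn hB)).
have Qn : Q`_n.+1 != 0.
  by have := lead_coef_eq0 Q; rewrite lead_coefE sQ -size_poly_eq0 sQ => ->.
have sgn_Qn : (-1) ^+ n.+1 * Q`_n.+1 != 0 by rewrite mulf_neq0 ?signr_eq0.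
(* The top coefficient of B is that of the numerator, which is a nonzero multiple of P(-W) modulo
   Q. *)
have l_PN m : (forall i, l ('X^m * B`_i) = 0) -> l ('X^m * (P \Po - 'X)) = 0.
  move=> lXB; apply: (mulfI sgn_Qn); rewrite mulr0 -[RHS](lXB n).
  have <- : (bezout_num P Q)`_n.+1 = B`_n.
    by rewrite (bezoutian_coefS n hB) (Bhigh n.+1) // mul0r addr0.
  by rewrite coef_bezout_num mulrBr -!scalerAr lB !lZ lQ mulr0 subr0.
(* Induction on m, trading W times the coefficient i of B for the coefficient i of the numerator
   minus the previous coefficient of B. *)
have l_B m i : l ('X^m * B`_i) = 0.
  elim: m i => [|m IHm] i.
    rewrite mul1r; have [ni|ni] := ltnP n i.
      by rewrite Bhigh // -[0](mul0r Q) lQ.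
    rewrite l_small ?(size_coef_bezoutian _ sPn sQn hB) //.
    have := congr1 (fun A : 'rV_n.+1 => A 0 (Ordinal (ni : i < n.+1)%N)) cB.
    by rewrite [RHS]mxE mxE => e; rewrite -[RHS]e; apply: eq_bigr => k _; rewrite !mxE.
  have l_num : l ('X^m * (bezout_num P Q)`_i) = 0.
    by rewrite coef_bezout_num mulrBr -!scalerAr lB !lZ l_PN // lQ !mulr0 subr0.
  rewrite exprSr -mulrA (mulrC 'X); move: l_num.
  case: i => [|i]; first by rewrite (bezoutian_coef0 hB).
  by rewrite (bezoutian_coefS i hB) mulrDr lD IHm add0r.
have l_all p : l (p * (P \Po - 'X)) = 0.
  rewrite -[p]coefK poly_def mulr_suml.
  apply: (big_ind (fun q => l q = 0)); first by rewrite -[0](mul0r Q) lQ.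
    by move=> q r lq lr; rewrite lD lq lr addr0.
  by move=> k _; rewrite -scalerAl lZ l_PN ?mulr0.
case/eqP: nz_c; apply/rowP=> k; rewrite mxE.
have : l 'X^k = 0.
  by rewrite -[_ ^+ k]mulr1 -uv1 mulrDr !mulrA lD lQ l_all addr0.
rewrite l_small ?size_polyXn // (bigD1 k) //= big1 => [|j].
  by rewrite coefXn eqxx mulr1 addr0.
by rewrite -val_eqE coefXn => /negPf->; rewrite mulr0.
Qed.

End BezoutianKernel.

(** * The path F_t *)

Section RealPartPath.
Variable F : fieldType.

(** This is total degree at most n in Z and t: for i > n the truncated subtraction makes the
    coefficient vanish. *)
Definition weighted n (p : {poly {poly F}}) :=
  forall i, (size (p`_i)%R <= n.+1 - i)%N.

Lemma weightedM m n p q : weighted m p -> weighted n q -> weighted (m + n) (p * q).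
Proof.
move=> hp hq i; rewrite coefM; apply: (leq_trans (size_sum _ _ _)).
apply/bigmax_leqP=> j _; have := hp j; have := hq (i - j)%N.
have [->|nzp] := eqVneq p`_j 0; first by rewrite mul0r size_poly0.
have [->|nzq] := eqVneq q`_(i - j) 0; first by rewrite mulr0 size_poly0.
rewrite size_mul //; move: nzp nzq (ltn_ord j); rewrite -!size_poly_gt0.
by move: (size _) (size _) => a b; lia.
Qed.

Lemma weightedX m p k : weighted m p -> weighted (m * k) (p ^+ k).
Proof.
move=> hp; elim: k => [|k IHk]; last by rewrite exprS mulnS; apply: weightedM.
by move=> i; rewrite expr0 muln0 coefC; case: i => [|i]; rewrite ?size_poly1 ?size_poly0.
Qed.

(* t^n f((Z + t - 1) / t) as a polynomial in t, so that t = 0 gives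
   (Z - 1)^n and t = 1 gives f *)
Definition shift_path (f : {poly F}) n : {poly {poly F}} :=
  \sum_(m < n.+1) (f`_m *: 'X^(n - m))%:P * ('X + ('X - 1)%:P) ^+ m.

Lemma weighted_shift_path f n : weighted n (shift_path f n).
Proof.
move=> i; rewrite coef_sum; apply: (leq_trans (size_sum _ _ _)).
apply/bigmax_leqP=> m _.
have hm : (n - m + 1 * m = n)%N by have := ltn_ord m; lia.
suff h : weighted (n - m + 1 * m)
    ((f`_m *: 'X^(n - m))%:P * ('X + ('X - 1)%:P) ^+ m).
  by have := h i; rewrite hm.
apply: weightedM.
  move=> j; rewrite coefC; case: j => [|j]; last by rewrite size_poly0.
  by rewrite subn0 (leq_trans (size_scale_leq _ _)) // size_polyXn.
apply: weightedX => j; rewrite coefD coefX coefC.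
case: j => [|[|j]] /=; rewrite ?add0r ?addr0 ?size_poly1 ?size_poly0 //.
by rewrite size_XsubC.
Qed.

Definition shift_at (f : {poly F}) n (x : F) : {poly F} :=
  \sum_(m < n.+1) (f`_m * x ^+ (n - m)) *: ('X + (x - 1)%:P) ^+ m.

Lemma eval_shift_path f n x :
  map_poly (horner_eval x) (shift_path f n) = shift_at f n x.
Proof.
rewrite rmorph_sum; apply: eq_bigr => m _; rewrite rmorphM rmorphXn rmorphD /=.
rewrite map_polyX !map_polyC /= /horner_eval hornerZ hornerXn !hornerE.
by rewrite mul_polyC.
Qed.

Lemma horner_shift_at (f : {poly F}) n x z : x != 0 -> (size f <= n.+1)%N ->
  (shift_at f n x).[z] = x ^+ n * f.[(z + (x - 1)) / x].
Proof.
move=> nzx sf; rewrite (horner_coef_wide _ sf) mulr_sumr horner_sum.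
apply: eq_bigr => m _; rewrite hornerZ horner_exp hornerD hornerX hornerC.
have -> : x ^+ n = x ^+ (n - m) * x ^+ m.
  by rewrite -exprD subnK // -ltnS.
rewrite expr_div_n.
by field; rewrite expf_neq0.
Qed.

Lemma size_XaddC_exp (c : F) m : size (('X + c%:P) ^+ m) = m.+1.
Proof. by rewrite -[c%:P]opprK -polyCN size_exp_XsubC. Qed.

Lemma XaddC_exp_monic (c : F) m : ('X + c%:P) ^+ m \is monic.
Proof. by rewrite -[c%:P]opprK -polyCN monic_exp // monicXsubC. Qed.

Lemma coef_XaddC_exp (c : F) m : (('X + c%:P) ^+ m.+1)`_m = c *+ m.+1.
Proof.
elim: m => [|m IHm]; first by rewrite expr1 coefD coefX coefC add0r.
rewrite exprSr mulrDr coefD coefMX coefMC /= IHm.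
have := monicP (XaddC_exp_monic c m.+1); rewrite lead_coefE size_XaddC_exp /= => ->.
by rewrite mul1r -mulrSr.
Qed.

Section MonicShift.
Variables (f : {poly F}) (n : nat).
Hypotheses (mon_f : f \is monic) (sf : size f = n.+2) (fn : f`_n = 0).
Local Notation N := n.+1.

Lemma shift_atE x : shift_at f N x = ('X + (x - 1)%:P) ^+ N +
  \sum_(m < n) (f`_m * x ^+ (N - m)) *: ('X + (x - 1)%:P) ^+ m.
Proof.
rewrite /shift_at !big_ord_recr /= fn mul0r scale0r addr0 addrC; congr (_ + _).
have := monicP mon_f; rewrite lead_coefE sf /= => ->.
by rewrite subnn mulr1 scale1r.
Qed.

Lemma coef_shift_at_tail x i : (n <= i)%N ->
  (\sum_(m < n) (f`_m * x ^+ (N - m)) *: ('X + (x - 1)%:P) ^+ m)`_i = 0.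
Proof.
move=> ni; rewrite coef_sum big1 // => m _; rewrite coefZ.
rewrite [X in _ * X]nth_default ?mulr0 // size_XaddC_exp.
exact: leq_trans (ltn_ord m) ni.
Qed.

Lemma shift_at_coefN x : (shift_at f N x)`_N = 1.
Proof.
rewrite shift_atE coefD coef_shift_at_tail // addr0.
by have := monicP (XaddC_exp_monic (x - 1) N); rewrite lead_coefE size_XaddC_exp.
Qed.

Lemma shift_at_coefn x : (shift_at f N x)`_n = (x - 1) *+ N.
Proof. by rewrite shift_atE coefD coef_shift_at_tail // addr0 coef_XaddC_exp. Qed.

Lemma size_shift_at x : size (shift_at f N x) = N.+1.
Proof.
apply/eqP; rewrite eqn_leq; apply/andP; split; last first.
  rewrite ltnNge; apply/negP => /leq_sizeP/(_ N (leqnn _))/eqP.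
  by rewrite shift_at_coefN oner_eq0.
apply: (leq_trans (size_sum _ _ _)); apply/bigmax_leqP=> m _.
by apply: (leq_trans (size_scale_leq _ _)); rewrite size_XaddC_exp.
Qed.

Lemma shift_at0 : shift_at f N 0 = ('X - 1) ^+ N.
Proof.
rewrite shift_atE big1 ?addr0 => [|m _]; first by rewrite sub0r polyCN.
by rewrite expr0n subn_eq0 leqNgt (leqW (ltn_ord m)) /= mulr0 scale0r.
Qed.

Lemma shift_at1 : shift_at f N 1 = f.
Proof.
rewrite -[RHS]coefK poly_def sf /shift_at; apply: eq_bigr => m _.
by rewrite subrr addr0 expr1n mulr1.
Qed.

End MonicShift.

(** The numerator has total degree at most 2n in Z, W and t, and dividing by the linear form Z + W
    lowers this to 2n - 1. *)
Lemma size_coef2_bezoutian n (P Q : {poly {poly F}}) B i j :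
    weighted n P -> weighted n Q -> bezoutian P Q B ->
  (size (B`_i`_j)%R <= n.*2 - i - j)%N.
Proof.
move=> wP wQ hB.
have sM (p q : {poly F}) a b : (size p <= n.+1 - a)%N -> (size q <= n.+1 - b)%N ->
    (size (p * q)%R <= n.*2.+1 - a - b)%N.
  have [->|nzp] := eqVneq p 0; first by rewrite mul0r size_poly0.
  have [->|nzq] := eqVneq q 0; first by rewrite mulr0 size_poly0.
  rewrite size_mul //; move: nzp nzq; rewrite -!size_poly_gt0.
  by move: (size _) (size _) => c d; lia.
have sB (p q : {poly F}) k :
    (size p <= k)%N -> (size q <= k)%N -> (size (p - q)%R <= k)%N.
  move=> sp sq; apply: (leq_trans (size_polyD _ _)).
  by rewrite geq_max size_polyN sp.
have sN a b : (size ((bezout_num P Q)`_a`_b)%R <= n.*2.+1 - a - b)%N.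
  rewrite coef2_bezout_num; apply: sB; last exact: sM.
  by rewrite size_Msign; apply: sM.
elim: i j => [|i IHi] j; rewrite (bezoutian_coef2 _ _ hB).
  by rewrite subr0; apply: leq_trans (sN _ _) _; lia.
by apply: sB; [apply: leq_trans (sN _ _) _ | apply: leq_trans (IHi _) _]; lia.
Qed.

End RealPartPath.

(** * Definiteness of the Bezoutian along the path *)

Section HermitianBezoutian.
Variables (R : realFieldType) (C : fieldType) (K : complexification R C).
Local Notation cconj := (cconj K).
Local Notation emb := (emb K).
Local Notation cre := (cre K).

Lemma natC_neq0 n : n.+1%:R != 0 :> C.
Proof. by rewrite -(rmorph_nat emb) fmorph_eq0 pnatr_eq0. Qed.

Definition bezout_mx n (B : {poly {poly C}}) : 'M[C]_n :=
  \matrix_(i < n, j < n) B`_i`_j.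

Lemma bezout_mx_hermitian n P B :
  bezoutian P (map_poly cconj P) B -> hermitian K (bezout_mx n B).
Proof.
move=> hB; apply/matrixP=> i j; rewrite !mxE.
by apply: bezoutian_hermitian hB; apply: cconjK.
Qed.

(* (Z + 1)^n (W + 1)^n - (Z - 1)^n (W - 1)^n is divided by
   (Z + 1) (W + 1) - (Z - 1) (W - 1) = 2 (Z + W), and the terms of the
   quotient are products G(Z) G(W) with G real. *)
Lemma bezoutian_power n (P := ('X - 1) ^+ n : {poly C}) :
  bezoutian P P (\sum_(l < n)
    let G := ('X + 1) ^+ (n.-1 - l) * ('X - 1) ^+ l in G^:P * G%:P *+ 2).
Proof.
pose x : {poly {poly C}} := ('X + 1) * ('Y + 1).
pose y : {poly {poly C}} := ('X - 1) * ('Y - 1).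
have PN : P \Po - 'X = (-1) ^+ n * ('X + 1) ^+ n.
  rewrite /P rmorphXn /= rmorphB /= comp_polyX rmorph1 -exprMn; congr (_ ^+ n).
  by ring.
rewrite /bezoutian /bezout_num PN.
have -> : ((-1) ^+ n * ('X + 1) ^+ n)^:P * ((-1) ^+ n * ('X + 1) ^+ n)%:P
          - P^:P * P%:P = x ^+ n - y ^+ n.
  rewrite /P !(rmorphM, rmorphXn, rmorphD, rmorphB, rmorphN, rmorph1) /= map_polyX.
  by rewrite mulrACA -exprMn mulrNN mulr1 expr1n mul1r -!exprMn.
rewrite subrXX mulrC mulr_suml mulr_suml; apply: eq_bigr => l _ /=.
rewrite !(rmorphM, rmorphXn, rmorphD, rmorphB, rmorphN, rmorph1) /= map_polyX.
have -> : x - y = 2%:R * ('X + 'Y) by rewrite /x /y; ring.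
rewrite !exprMn -subn1 -subnDA add1n.
by ring.
Qed.

(** By [bezoutian_power] the form is twice a sum of squared norms, hence semidefinite. It is
    nonsingular because Z - 1 and -Z - 1, whose sum is the unit -2, are coprime. *)
Lemma posdef_bezout_power n B (P := ('X - 1) ^+ n : {poly C}) :
  bezoutian P P B -> posdef K (bezout_mx n B).
Proof.
move=> hB.
have P_real : map_poly cconj P = P.
  by rewrite rmorphXn rmorphB /= map_polyX rmorph1.
apply: semidef_unit_posdef.
- by apply: (@bezout_mx_hermitian _ P); rewrite P_real.
- move=> v; rewrite (bezoutian_inj hB (bezoutian_power n)).
  pose G l : {poly C} := ('X + 1) ^+ (n.-1 - l) * ('X - 1) ^+ l.
  have G_real l i : cconj (G l)`_i = (G l)`_i.
    rewrite -coef_map /G rmorphM !rmorphXn rmorphD rmorphB /= map_polyX.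
    by rewrite rmorph1.
  pose g : 'M[C]_n := \matrix_(l < n, i < n) (G l)`_i.
  have -> : bezout_mx n (\sum_(l < n) (G l)^:P * (G l)%:P *+ 2) =
            (adj K g *m g) *+ 2.
    apply/matrixP=> i j; rewrite !(mulmxnE, mxE) !coef_sum -sumrMnl.
    apply: eq_bigr => l _; rewrite !mxE G_real !coefMn coefMC coef_map /=.
    by rewrite mul_polyC coefZ.
  have -> : hform K ((adj K g *m g) *+ 2) v v =
            \sum_l (cconj ((g *m v) l 0) * (g *m v) l 0) * emb 2%:R.
    rewrite rmorph_nat /hform -scaler_nat -scalemxAr -scalemxAl mxE !mulmxA -adjM -mulmxA.
    by rewrite mxE mulr_sumr; apply: eq_bigr => l _; rewrite !mxE mulrC.
  rewrite raddf_sum sumr_ge0 // => l _; rewrite creM_emb.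
  by rewrite mulr_ge0 ?ler0n ?cre_sqnorm_ge0.
have sP : size P = n.+1 by rewrite /P -polyC1 size_exp_XsubC.
apply: (bezoutian_det_neq0 sP sP hB).
rewrite /P rmorphXn /= coprimep_expl // coprimep_expr //.
apply/Bezout_eq1_coprimepP; exists ((- 2%:R^-1)%:P, (- 2%:R^-1)%:P).
rewrite /= -mulrDr rmorphB /= comp_polyX rmorph1.
have -> : ('X - 1 + (- 'X - 1) : {poly C}) = - 2%:R%:P by rewrite polyC_natr; ring.
by rewrite -polyCN -polyCM mulrNN mulVf ?natC_neq0.
Qed.

Lemma map_conj_shift_at (f : {poly C}) n x :
  map_poly cconj (shift_at f n (emb x)) =
  shift_at (map_poly cconj f) n (emb x).
Proof.
rewrite rmorph_sum; apply: eq_bigr => m _ /=.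
rewrite -mul_polyC rmorphM rmorphXn rmorphD /= map_polyX !map_polyC /=.
by rewrite mul_polyC coef_map rmorphM rmorphXn rmorphB /= cconj_emb rmorph1.
Qed.

Section MinimalRootless.
Variables (f : {poly C}) (n : nat).
Hypotheses (mon_f : f \is monic) (sf : size f = n.+2) (fn : f`_n = 0).
Hypothesis rootless : forall z, f.[z] != 0.
Hypothesis minimal :
  forall g : {poly C}, (1 < size g <= n.+1)%N -> exists z, g.[z] = 0.

(* A minimal rootless polynomial is irreducible, so a common factor of the two
   polynomials would make them proportional; their subleading coefficients
   then force x = 1. *)
Lemma shift_at_coprime x : cconj f`_0 != (-1) ^+ n.+1 * f`_0 -> x != 0 ->
  coprimep (map_poly cconj (shift_at f n.+1 (emb x)))
           (shift_at f n.+1 (emb x) \Po - 'X).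
Proof.
move=> f0 nzx; set P := shift_at _ _ _; set Q := map_poly _ P.
set P' := P \Po _; set g := gcdp Q P'.
have sP : size P = n.+2 by apply: size_shift_at.
have sQ : size Q = n.+2 by rewrite size_map_poly.
have sP' : size P' = n.+2 by rewrite size_comp_poly2 // size_polyN size_polyX.
have nzQ : Q != 0 by rewrite -size_poly_eq0 sQ.
apply/negPn/negP; rewrite coprimep_def -/g => sg1.
have sg0 : (0 < size g)%N by rewrite size_poly_gt0 gcdp_eq0 negb_and nzQ.
have P_rootless z : P.[z] != 0.
  rewrite horner_shift_at ?sf ?fmorph_eq0 // mulf_neq0 ?rootless //.
  by rewrite expf_neq0 ?fmorph_eq0.
have [sg|sg] := leqP (size g) n.+1.
  have [|z gz] := minimal (g := g); first by rewrite sg andbT ltn_neqAle eq_sym sg1 sg0.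
  have /dvdpP[q eP'] : g %| P' by apply: dvdp_gcdr.
  have /eqP[] := P_rootless (- z).
  have : P'.[z] = 0 by rewrite eP' hornerM gz mulr0.
  by rewrite horner_comp hornerN hornerX.
have gQ : g %= Q.
  by rewrite -dvdp_size_eqp ?dvdp_gcdl // eqn_leq sQ sg -sQ leq_gcdpl.
have gP' : g %= P'.
  rewrite -dvdp_size_eqp ?dvdp_gcdr // eqn_leq sP' sg -sP' leq_gcdpr //.
  by rewrite -size_poly_eq0 sP'.
have /eqpP[[c1 c2] /andP[/= nz1 nz2] eqc] : Q %= P'.
  by apply: eqp_trans gP'; rewrite eqp_sym.
(* Index n + 1 fixes the ratio of c1 and c2. At index n the real coefficient then equals its
   opposite, whence x = 1, and index 0 contradicts the assumption on f(0). *)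
have ec i : c1 * cconj P`_i = c2 * ((-1) ^+ i * P`_i).
  by have := congr1 (fun p : {poly C} => p`_i) eqc; rewrite !coefZ coef_map coef_comp_polyN.
have e2 : c1 = c2 * (-1) ^+ n.+1.
  by have := ec n.+1; rewrite shift_at_coefN // rmorph1 !mulr1.
have x1 : x = 1.
  have ex : (emb x - 1) *+ n.+1 = emb ((x - 1) *+ n.+1).
    by rewrite rmorphMn rmorphB rmorph1.
  have := ec n; rewrite shift_at_coefn // ex cconj_emb e2 exprS => e.
  have /eqP : c2 * (-1) ^+ n * emb ((x - 1) *+ n.+1) *+ 2 = 0.
    move: ((-1) ^+ n) (emb _) e => s y e.
    by rewrite -(subrr (c2 * (s * y))) -{2}e; ring.
  rewrite -mulr_natr !mulf_eq0 (negbTE nz2) signr_eq0 /= fmorph_eq0.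
  by rewrite (negbTE (natC_neq0 1)) orbF mulrn_eq0 /= subr_eq0 => /eqP.
case/eqP: f0; apply: (mulfI nz1); have := ec 0%N.
by rewrite /P x1 rmorph1 shift_at1 // expr0 mul1r => ->; rewrite e2 -mulrA signrMK.
Qed.

Lemma minimal_rootless_coef0 N : IVT R N -> (n.+1 ^ 2 <= N)%N ->
  cconj f`_0 = (-1) ^+ n.+1 * f`_0.
Proof.
move=> ivt nN; apply/eqP/negPn/negP => f0.
pose P := shift_path f n.+1; pose Q := shift_path (map_poly cconj f) n.+1.
have [B hB] := bezoutian_exists P Q.
pose M : 'M[{poly C}]_n.+1 := \matrix_(i, j) B`_i`_j.
pose Px x := shift_at f n.+1 (emb x).
pose Bx x := map_poly (map_poly (horner_eval (emb x))) B.
have hBx x : bezoutian (Px x) (map_poly cconj (Px x)) (Bx x).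
  have := bezoutian_map (horner_eval (emb x)) hB.
  by rewrite !eval_shift_path -map_conj_shift_at.
have evM x : eval_mx K M x = bezout_mx n.+1 (Bx x).
  by apply/matrixP=> i j; rewrite !mxE !coef_map.
have hM x : hermitian K (eval_mx K M x).
  by rewrite evM; apply: bezout_mx_hermitian (hBx x).
have pM0 : posdef K (eval_mx K M 0).
  rewrite evM; apply: posdef_bezout_power.
  have := hBx 0; rewrite /Px rmorph0 shift_at0 //.
  by rewrite rmorphXn rmorphB /= map_polyX rmorph1.
have detM x : 0 <= x <= 1 -> \det (eval_mx K M x) != 0.
  move=> _; have [->|nzx] := eqVneq x 0.
    by apply: contraTneq (posdef_det (hM 0) pM0) => ->; rewrite raddf0 ltxx.
  have sPx : size (Px x) = n.+2 by apply: size_shift_at.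
  rewrite evM; apply: (bezoutian_det_neq0 sPx _ (hBx x)).
    by rewrite size_map_poly.
  exact: shift_at_coprime.
(* With these weights the numbers 2 e i + 1 are the first n + 1 odd numbers, of sum (n + 1)^2. *)
pose e (i : 'I_n.+1) := (n - i)%N.
have sM i j : (size (M i j) <= e i + e j + 2)%N.
  rewrite mxE; apply: leq_trans (size_coef2_bezoutian _ _ _ _ hB) _.
  - exact: weighted_shift_path.
  - exact: weighted_shift_path.
  by rewrite /e; have := ltn_ord i; have := ltn_ord j; lia.
have eN : (\sum_i (e i).*2.+1 <= N)%N.
  apply: leq_trans nN; rewrite (reindex_inj rev_ord_inj) /=.
  rewrite (eq_bigr (fun i : 'I_n.+1 => i.*2.+1)) => [|i _]; last first.
    by rewrite /e /= subKn // -ltnS.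
  elim: n.+1 => [|m IHm]; first by rewrite big_ord0.
  by rewrite big_ord_recr /=; lia.
have x01 : 0 <= (1 : R) <= 1 by rewrite ler01 lexx.
have := posdef_path ivt sM eN hM pM0 detM x01.
(* This vector isolates the last diagonal entry. At t = 1 that entry is a coefficient of the
   numerator, each of whose terms contains the vanishing subleading coefficient of f or its
   conjugate. *)
pose v : 'cV[C]_n.+1 := delta_mx ord_max 0.
have nz_v : v != 0.
  apply/negP => /eqP/matrixP/(_ ord_max 0); rewrite !mxE !eqxx => /eqP.
  by rewrite oner_eq0.
move=> /(_ v nz_v); rewrite evM.
have -> : hform K (bezout_mx n.+1 (Bx 1)) v v = (Bx 1)`_n`_n.
  rewrite /hform -colE mxE mxE (bigD1 ord_max) //= big1 => [|i /negPf ni].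
    by rewrite !mxE !eqxx rmorph1 mul1r addr0.
  by rewrite !mxE ni rmorph0 mul0r.
have -> : (Bx 1)`_n`_n = 0; last by rewrite raddf0 ltxx.
have Bhigh : (Bx 1)`_n.+1 = 0.
  by rewrite nth_default // (size_bezoutian _ _ (hBx 1)) ?size_map_poly ?size_shift_at.
have := bezoutian_coefS n (hBx 1); rewrite Bhigh mul0r addr0 => <-.
rewrite coef2_bezout_num !coef_map /Px rmorph1 shift_at1 // fn.
by rewrite /= rmorph0 !mulr0 subrr.
Qed.

End MinimalRootless.

End HermitianBezoutian.

(** * Rootless polynomials *)

Section Descent.
Variables (R : realFieldType) (C : fieldType) (K : complexification R C).
Local Notation cconj := (cconj K).

Lemma depressed_monic (F : {poly C}) n : size F = n.+2 ->
  exists (f : {poly C}) (a s : C), [/\ f \is monic, size f = n.+2, f`_n = 0,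
    a != 0 & forall z, f.[z] = a * F.[z + s]].
Proof.
move=> sF; pose lc := F`_n.+1.
have nz_lc : lc != 0.
  by have := lead_coef_eq0 F; rewrite lead_coefE sF -size_poly_eq0 sF => ->.
have nzN : n.+1%:R != 0 :> C by apply: natC_neq0 K n.
(* The Tschirnhaus translation that removes the subleading coefficient. *)
pose s := - F`_n / (lc * n.+1%:R).
have q2 : size ('X + s%:P) = 2%N by rewrite -[_ + _]expr1 size_XaddC_exp.
pose f0 := F \Po ('X + s%:P).
have sf0 : size f0 = n.+2 by rewrite size_comp_poly2.
have f0E : f0 = F`_n.+1 *: ('X + s%:P) ^+ n.+1 + (F`_n *: ('X + s%:P) ^+ n +
    \sum_(m < n) F`_m *: ('X + s%:P) ^+ m).
  by rewrite /f0 comp_polyE sF !big_ord_recr /= addrC; congr (_ + _); apply: addrC.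
have tail i : (n <= i)%N -> (\sum_(m < n) F`_m *: ('X + s%:P) ^+ m)`_i = 0.
  move=> ni; rewrite coef_sum big1 // => m _; rewrite coefZ.
  rewrite [X in _ * X]nth_default ?mulr0 // size_XaddC_exp.
  exact: leq_trans (ltn_ord m) ni.
have lead m : (('X + s%:P) ^+ m)`_m = 1.
  by have := monicP (XaddC_exp_monic s m); rewrite lead_coefE size_XaddC_exp.
have f0n : f0`_n = 0.
  rewrite f0E !coefD !coefZ tail // addr0 coef_XaddC_exp lead -mulr_natr.
  have -> : F`_n.+1 * (s * n.+1%:R) = s * (lc * n.+1%:R) by rewrite mulrCA.
  by rewrite divfK ?mulf_neq0 // mulr1 addNr.
have f0N : f0`_n.+1 = lc.
  rewrite f0E !coefD !coefZ tail // lead mulr1 addr0.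
  by rewrite [X in _ * X]nth_default ?size_XaddC_exp // mulr0 addr0.
exists (lc^-1 *: f0), lc^-1, s; split.
- by rewrite monicE lead_coefZ lead_coefE sf0 /= f0N mulVf.
- by rewrite size_scale ?invr_eq0.
- by rewrite coefZ f0n mulr0.
- by rewrite invr_eq0.
by move=> z; rewrite hornerZ horner_comp hornerD hornerX hornerC.
Qed.

(** The rescaling stays monic, depressed and rootless while dividing the constant coefficient by an
    arbitrary power u^(n + 1). *)
Lemma rescale_monic (f : {poly C}) n (u : C) :
    f \is monic -> size f = n.+2 -> f`_n = 0 -> u != 0 ->
  exists g : {poly C}, [/\ g \is monic, size g = n.+2, g`_n = 0,
    g`_0 = f`_0 / u ^+ n.+1 & forall z, g.[z] = f.[u * z] / u ^+ n.+1].
Proof.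
move=> mf sf fn nzu; have nzuN : u ^+ n.+1 != 0 by rewrite expf_neq0.
have fN : f`_n.+1 = 1 by have := monicP mf; rewrite lead_coefE sf.
pose g := \poly_(i < n.+2) (f`_i * u ^+ i / u ^+ n.+1).
have gN : g`_n.+1 = 1 by rewrite coef_poly ltnSn fN mul1r divff.
have sg : size g = n.+2 by rewrite size_poly_eq // fN mul1r divff ?oner_eq0.
exists g; split=> //.
- by rewrite monicE lead_coefE sg gN.
- by rewrite coef_poly leqnSn fn !mul0r.
- by rewrite coef_poly /= mulr1.
move=> z; rewrite horner_poly horner_coef sf mulr_suml; apply: eq_bigr => i _.
by rewrite exprMn; ring.
Qed.

(** Taking u = 1 + i k for natural numbers k would make every k a root of p, which has only finitely
    many. *)
Lemma power_not_always_real (im : C) n :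
    im ^+ 2 = -1 -> cconj im = - im ->
  ~ forall u, u != 0 -> cconj (u ^+ n.+1) = u ^+ n.+1.
Proof.
move=> im2 cim real_pow.
pose p : {poly C} := (1 + im *: 'X) ^+ n.+1 - (1 - im *: 'X) ^+ n.+1.
have pE z : p.[z] = (1 + im * z) ^+ n.+1 - (1 - im * z) ^+ n.+1.
  by rewrite !hornerE.
have nz_p : p != 0.
  (* At X = i the first power vanishes and the second is 2^(n + 1). *)
  have : p.[im] != 0.
    rewrite pE -expr2 im2 subrr expr0n /= sub0r oppr_eq0 opprK expf_neq0 //.
    exact: natC_neq0 K 1%N.
  by apply: contraNneq => ->; rewrite horner0.
have root_p k : root p k%:R.
  apply/rootP; rewrite pE.
  have ck : cconj (1 + im * k%:R) = 1 - im * k%:R.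
    by rewrite rmorphD rmorphM rmorph1 rmorph_nat cim mulNr.
  have nz : 1 + im * k%:R != 0.
    have n1 : (1 + im * k%:R) * (1 - im * k%:R) = (1 + k ^ 2)%:R.
      have -> : (1 + im * k%:R) * (1 - im * k%:R) = 1 - im ^+ 2 * k%:R ^+ 2 by ring.
      by rewrite im2 natrD natrX; ring.
    apply: contraTneq (natC_neq0 K (k ^ 2)) => e0.
    by rewrite -add1n -n1 e0 mul0r eqxx.
  by rewrite -ck -rmorphXn real_pow ?subrr.
pose rs : seq C := [seq k%:R | k <- iota 0 (size p)].
have : (size rs < size p)%N.
  apply: max_poly_roots => //; first by apply/allP=> _ /mapP[k _ ->].
  rewrite map_inj_uniq ?iota_uniq // => i j /eqP.
  by rewrite -!(rmorph_nat (emb K)) (inj_eq (fmorph_inj _)) eqr_nat => /eqP.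
by rewrite size_map size_iota ltnn.
Qed.

Lemma IVT_root (im : C) d (F : {poly C}) :
    im ^+ 2 = -1 -> cconj im = - im -> IVT R (d ^ 2)%N ->
    (1 < size F <= d.+1)%N ->
  exists z, F.[z] = 0.
Proof.
(* Only the degree bound varies in the induction; IVT is kept at d^2 throughout. *)
move=> im2 cim ivt; elim: {-2}d (leqnn d) F => [|n IHn] nd F.
  by case: (size F) => [|[]].
move=> /andP[F1]; rewrite leq_eqVlt => /orP[/eqP sF|]; last first.
  by move=> sF; apply: IHn (ltnW nd) _ _; rewrite F1.
apply: NNPP => rootless.
have [f [a [s [mf sf fn nza fE]]]] := depressed_monic sF.
have f_rootless z : f.[z] != 0.
  rewrite fE mulf_neq0 //; apply/eqP => Fz; case: rootless.
  by exists (z + s).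
have nN : (n.+1 ^ 2 <= d ^ 2)%N by rewrite leq_sqr.
have f0 u : u != 0 ->
    cconj (f`_0 / u ^+ n.+1) = (-1) ^+ n.+1 * (f`_0 / u ^+ n.+1).
  move=> nzu; have [g [mg sg gn <- gE]] := rescale_monic mf sf fn nzu.
  apply: (minimal_rootless_coef0 K mg sg gn _ _ ivt nN).
    by move=> z; rewrite gE mulf_neq0 ?invr_eq0 ?expf_neq0.
  by move=> h; apply: IHn (ltnW nd) h.
have nzf0 : f`_0 != 0 by rewrite -horner_coef0.
apply: (power_not_always_real (n := n) im2 cim) => u nzu.
(* Dividing the relation for u by the one for u = 1 cancels f(0) and the sign, so that u^(n + 1) is
   real. *)
have f01 := f0 1 (oner_neq0 _); rewrite expr1n divr1 in f01.
have := f0 u nzu; rewrite rmorphM fmorphV f01 mulrA.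
by move/(mulfI _) => h; apply: invr_inj; apply: h; rewrite mulf_neq0 ?signr_eq0.
Qed.

End Descent.

(** * Conjugation and real part on R[i] *)

Section ComplexNumbers.
Variable R : realFieldType.

Definition conj_complex (z : R[i]) : R[i] :=
  let: (a +i* b)%C := z in (a -i* b)%C.

Definition re_complex (z : R[i]) : R := complex.Re z.

Fact conj_complex_zmod_morphism : zmod_morphism conj_complex.
Proof. by case=> a b [c d]; apply/eqP; rewrite eq_complex /= !opprD !eqxx. Qed.

Fact conj_complex_monoid_morphism : monoid_morphism conj_complex.
Proof.
split=> [|[a b] [c d]]; apply/eqP; rewrite eq_complex /= ?oppr0 ?eqxx //.
by rewrite mulrNN mulrN mulNr opprD !eqxx.
Qed.

HB.instance Definition _ := GRing.isZmodMorphism.Build R[i] R[i] conj_complex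
  conj_complex_zmod_morphism.
HB.instance Definition _ := GRing.isMonoidMorphism.Build R[i] R[i] conj_complex
  conj_complex_monoid_morphism.

Fact re_complex_zmod_morphism : zmod_morphism re_complex.
Proof. by case=> a b [c d]. Qed.

HB.instance Definition _ :=
  GRing.isZmodMorphism.Build R[i] R re_complex re_complex_zmod_morphism.

Lemma re_complex_sqnorm z :
  re_complex (conj_complex z * z) = complex.Re z ^+ 2 + complex.Im z ^+ 2.
Proof. by case: z => a b; rewrite /re_complex /=; ring. Qed.

Definition complex_complexification : complexification R R[i].
Proof.
apply: (@Complexification R R[i] conj_complex (real_complex R) re_complex).
- by case=> a b; rewrite /= opprK.
- by move=> x; rewrite /= oppr0.
- by [].
- by case.
- by case=> a b x; rewrite /re_complex /= mulr0 subr0.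
- case=> a b /eqP; rewrite eq_complex /= => /andP[_ /eqP e].
  have -> : b = 0 by lra.
  by [].
- move=> z; rewrite [X in _ <= X](re_complex_sqnorm z).
  by rewrite addr_ge0 ?sqr_ge0.
move=> z; rewrite [X in X == _](re_complex_sqnorm z) paddr_eq0 ?sqr_ge0 // !sqrf_eq0.
by rewrite eq_complex.
Defined.

End ComplexNumbers.

Theorem theorem3 (R : realFieldType) (d : nat) (hd : (1 <= d)%N) :
  IVT R (d ^ 2)%N -> FTA R d.
Proof.
move=> ivt F F1 sF.
apply: (@IVT_root _ _ (complex_complexification R) 'i%C d F _ _ ivt).
- by apply/eqP; rewrite expr2 eq_complex /=; apply/andP; split; apply/eqP; ring.
- by apply/eqP; rewrite eq_complex /= oppr0 !eqxx.
by rewrite F1.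
Qed.
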